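(* Let $H$ be a complex Hilbert space and let $T\in B(H)$ be a rank one normal nonselfadjoint operator with $\operatorname{tr}T\neq 0$. The following are equivalent: (i) $\mathcal S(T,T^* )$ is an SI semigroup. (ii) $\|T\|=|\operatorname{tr}T|=1$. (iii) $\mathcal S(T,T^* )$ is a simple semigroup.
   Context: $H$ may be finite or infinite dimensional; $B(H)$ is the set of bounded linear operators on $H$. A semigroup $\mathcal S\subset B(H)$ is a subset closed under multiplication. $\mathcal S(T,T^* )$ is the semigroup generated by $\{T,T^*\}$, i.e. the set of all finite nonempty words in $T$ and $T^*$. An ideal $J$ of a semigroup $\mathcal S$ is a (two-sided) multiplicative ideal: a subset $J\subset\mathcal S$ with $XA, AX\in J$ for all $A\in J$, $X\in\mathcal S$ (no closure under sums or scalars is required). $\mathcal S$ is a selfadjoint-ideal (SI) semigroup if every ideal $J$ of $\mathcal S$ satisfies $\{A^*: A\in J\}\subset J$. $\mathcal S$ is simple if its only nonzero ideal (i.e. ideal containing a nonzero operator) is $\mathcal S$ itself; $\mathcal S$ may or may not contain $0$. $\operatorname{tr}$ denotes the trace and $\|\cdot\|$ the operator norm. *)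

(* Defs.v *)
From HB Require Import structures.
From mathcomp Require Import all_boot all_order all_algebra.
From mathcomp Require Import finmap complex.
From mathcomp Require Import all_classical all_reals topology normedtype.
From mathcomp Require Import showcase.summability.
Import Order.TTheory GRing.Theory Num.Theory.
Import numFieldNormedType.Exports.

Set Implicit Arguments.
Unset Strict Implicit.
Unset Printing Implicit Defensive.

Local Open Scope classical_set_scope.
Local Open Scope complex_scope.
Local Open Scope ring_scope.

(* A complex Hilbert space: a complete normed space over R[i] whose norm comes
   from an inner product, linear in its first argument. Norms in a normed
   module over R[i] are R[i]-valued (with real values). *)
Record hilbertType (R : realType) := HilbertType {
  hilbert_sort :> completeNormedModType R[i];
  inner : {dot hilbert_sort for Num.Def.conjC};
  inner_norm : forall x : hilbert_sort, inner x x = `|x| ^+ 2 }.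

Section Operators.
Context {R : realType} {H : hilbertType R}.
Local Notation "'<[' x , y ]>" := (@inner R H x y).

Definition boundedLinear : set (H -> H) :=
  [set A | linear A /\ exists M : R, forall x, `|A x| <= M%:C * `|x|].

(* For A in boundedLinear, the vector selected by xget exists by the Riesz
   representation theorem, and it is unique. *)
Definition adjoint (A : H -> H) : H -> H :=
  fun y => xget 0 [set z | forall x, <[A x, y]> = <[x, z]>].

Definition normal_op (A : H -> H) := A \o adjoint A = adjoint A \o A.

Definition selfadjoint (A : H -> H) := adjoint A = A.

Definition rank_one (A : H -> H) :=
  exists2 u : H, u <> 0 & range A = [set c *: u | c in [set: R[i]]].

Definition opnorm (A : H -> H) : R :=
  sup [set complex.Re `|A x| | x in [set x | `|x| <= 1]].

Definition orthonormal_set (E : set H) :=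
  forall e f, E e -> E f -> <[e, f]> = (e == f)%:R.

Definition orthonormal_basis (E : set H) :=
  orthonormal_set E /\
  forall F, orthonormal_set F -> E `<=` F -> F = E.

(* The series of the <A e, e> is summed unconditionally (along the net of finite
   subsets of E) since E may be uncountable. *)
Definition has_trace (A : H -> H) (t : R[i]) :=
  forall E, orthonormal_basis E ->
    partial_sum (fun e : E => <[A (val e), val e]> : R[i]^o) @ totally
      --> (t : R[i]^o).

(* At most one t qualifies, as an orthonormal basis exists; one does when A is
   trace class, in particular when A has finite rank. *)
Definition optrace (A : H -> H) : R[i] := xget 0 [set t | has_trace A t].

Definition semigroup (S : set (H -> H)) :=
  S `<=` boundedLinear /\ forall A B, S A -> S B -> S (A \o B).

Inductive words (G : set (H -> H)) : set (H -> H) :=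
| word_letter A : G A -> words G A
| word_cons A W : G A -> words G W -> words G (A \o W).

Definition semigroup_adj (T : H -> H) : set (H -> H) :=
  words [set T; adjoint T].

Definition semigroup_ideal (S J : set (H -> H)) :=
  J `<=` S /\ forall A X, J A -> S X -> J (X \o A) /\ J (A \o X).

Definition SI_semigroup (S : set (H -> H)) :=
  semigroup S /\
  forall J, semigroup_ideal S J -> [set adjoint A | A in J] `<=` J.

Definition simple_semigroup (S : set (H -> H)) :=
  semigroup S /\
  forall J, semigroup_ideal S J -> (exists2 A, J A & A <> cst 0) -> J = S.

End Operators.

(* Main.v *)
(** By the Riesz representation theorem [T = <., w> u] up to a scalar, and
    normality forces [u] and [w] to be parallel; hence [T = a P] with
    [P = <., e> e] the projection onto a unit vector [e], and [a] is both the
    trace and, in modulus, the norm of [T]. The semigroup generated by [T] and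
    its adjoint is [{a^m conj(a)^n P : m + n > 0}]. If [|a| = 1] it is a group
    with unit [P], so it has no proper nonempty ideal, and it is closed under
    adjoints. Conversely, if the principal ideal of [T] is selfadjoint and [T]
    is not, then [conj(a) = a a^m conj(a)^n] with [m + n > 0], and taking
    moduli gives [|a| = 1]. *)
Require Import Defs.
From HB Require Import structures.
From mathcomp Require Import all_boot all_order all_algebra ring lra.
From mathcomp Require Import finmap complex.
From mathcomp Require Import all_classical all_reals topology normedtype.
From mathcomp Require Import showcase.summability.
Import Order.TTheory GRing.Theory Num.Theory.
Import numFieldNormedType.Exports.

Set Implicit Arguments.
Unset Strict Implicit.
Unset Printing Implicit Defensive.

Local Open Scope classical_set_scope.
Local Open Scope complex_scope.
Local Open Scope ring_scope.

Section HilbertSpace.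
Context {R : realType} {H : hilbertType R}.
Local Notation "'<[' x , y ]>" := (@inner R H x y).
Implicit Types (x y z e v : H) (a b : R[i]) (T A : H -> H).

(** * Inner product identities and the Cauchy-Schwarz inequality *)

Lemma innerC x y : <[x, y]> = (<[y, x]>)^*%R.
Proof. by rewrite hermC expr0 mul1r. Qed.

Lemma innerZl a x y : <[a *: x, y]> = a * <[x, y]>.
Proof. by rewrite linearZl_LR. Qed.

Lemma innerZr a x y : <[x, a *: y]> = a^*%R * <[x, y]>.
Proof. by rewrite linearZr_LR. Qed.

Lemma innerBr x y z : <[x, y - z]> = <[x, y]> - <[x, z]>.
Proof. by rewrite linearBr. Qed.

Lemma inner_ext x y : (forall z, <[z, x]> = <[z, y]>) -> x = y.
Proof.
move=> xy; apply/eqP; rewrite -subr_eq0 -(dnorm_eq0 (@inner R H)).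
by rewrite innerBr xy subrr.
Qed.

Lemma parallelogram x y :
  `|x + y| ^+ 2 + `|x - y| ^+ 2 = 2 * `|x| ^+ 2 + 2 * `|y| ^+ 2.
Proof. by rewrite -!inner_norm dnormD dnormB /=; ring. Qed.

Lemma pythagoras x y : <[x, y]> = 0 -> `|x + y| ^+ 2 = `|x| ^+ 2 + `|y| ^+ 2.
Proof. by move=> xy0; rewrite -!inner_norm; exact: hnormDd. Qed.

Lemma pythagoras_unit e x : `|e| = 1 ->
  `|x| ^+ 2 = `|<[x, e]>| ^+ 2 + `|x - <[x, e]> *: e| ^+ 2.
Proof.
move=> e1; have ee : <[e, e]> = 1 by rewrite inner_norm e1 expr1n.
have := @pythagoras (<[x, e]> *: e) (x - <[x, e]> *: e).
rewrite subrKC normrZ e1 mulr1; apply.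
by rewrite innerZl innerBr innerZr ee mulr1 -innerC subrr mulr0.
Qed.

Lemma norm_inner_unit_le e x : `|e| = 1 -> `|<[x, e]>| <= `|x|.
Proof.
move=> e1; rewrite -(@ler_pXn2r _ 2) ?nnegrE//.
by rewrite (pythagoras_unit _ e1) lerDl exprn_ge0.
Qed.

Lemma cauchy_schwarz x y : `|<[x, y]>| <= `|x| * `|y|.
Proof.
have [->|y0] := eqVneq y 0; first by rewrite linear0r !normr0 mulr0.
have ny0 : `|y| != 0 by rewrite normr_eq0.
have e1 : `| `|y|^-1 *: y| = 1 by rewrite normrZ normfV normr_id mulVf.
have := norm_inner_unit_le x e1; rewrite innerZr normrM norm_conjC normfV.
by rewrite normr_id ler_pdivrMl ?lt_def ?ny0 ?normr_ge0// mulrC.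
Qed.

(** * Minimal vectors and the Riesz representation theorem *)

(** Norms are [R[i]]-valued; infima and real arithmetic need a value in [R]. *)
Definition rnorm x : R := complex.Re `|x|.

Lemma rnormE x : `|x| = (rnorm x)%:C.
Proof. by rewrite /rnorm RRe_real// normr_real. Qed.

Lemma rnorm_ge0 x : 0 <= rnorm x.
Proof. by rewrite -lecR -rnormE rmorph0 normr_ge0. Qed.

(** Near-minimizers of the norm on the hyperplane [f = 1] form a Cauchy filter by the parallelogram
    law. Its limit stays on the hyperplane because [f] is bounded. *)
Lemma min_norm_vector (f : {scalar H}) (M : R) :
  (forall x, `|f x| <= M%:C * `|x|) -> (exists x, f x != 0) ->
  exists2 x, f x = 1 & forall y, f y = 1 -> `|x| <= `|y|.
Proof.
move=> fM [x0 fx0].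
pose D : set R := [set rnorm x | x in [set x | f x = 1]].
have D0 : D !=set0.
  by exists (rnorm ((f x0)^-1 *: x0)); exists ((f x0)^-1 *: x0) => //=;
     rewrite linearZ /= mulVf.
have lbD : has_lbound D by exists 0 => _ [x _ <-]; exact: rnorm_ge0.
pose d := inf D.
have d_le y : f y = 1 -> d <= rnorm y.
  by move=> fy; apply: ge_inf => //; exists y.
have d_ge0 : 0 <= d by apply: lb_le_inf => // _ [x _ <-]; exact: rnorm_ge0.
pose B (r : R) : set H := [set x | f x = 1 /\ rnorm x < d + r].
pose F := filter_from [set r : R | 0 < r] B.
have F_filter : ProperFilter F.
  apply: filter_from_proper => [|r /= r0].
    apply: filter_from_filter; first by exists 1 => /=.
    move=> r s /= r0 s0; exists (Num.min r s) => /=; first by rewrite lt_min r0.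
    by move=> x [fx]; rewrite -ltrBlDl lt_min => /andP[]; rewrite !ltrBlDl.
  have [|_ [x fx <-] xdr] := @inf_adherent _ D r r0; first by split.
  by exists x; split.
(* The midpoint of [x] and [y] lies on the hyperplane again. *)
have halfB x y : f x = 1 -> f y = 1 -> 2 * d <= rnorm (x + y).
  move=> fx fy; have := d_le (2^-1 *: (x + y)).
  rewrite linearZ linearD fx fy /= mulVf ?pnatr_eq0// => /(_ erefl).
  have -> : rnorm (2^-1 *: (x + y)) = 2^-1 * rnorm (x + y).
    apply: (@complexI R); rewrite rmorphM /= -!rnormE normrZ normfV normr_nat.
    by rewrite rmorphV ?unitfE ?pnatr_eq0// rmorph_nat.
  by move=> ?; lra.
have : cauchy F.
  apply: cauchy_exP => eps eps0.
  have epsE : eps = (complex.Re eps)%:C by rewrite RRe_real// gtr0_real.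
  move: eps0; rewrite epsE ltcR; set s := complex.Re eps => s0.
  (* The parallelogram law gives [|x - y|^2 < 4 (d + r)^2 - 4 d^2 = r (8 d + 4 r)], which is at most
     [s^2] for this [r <= 1]. *)
  pose r := Num.min 1 (s ^+ 2 / (8 * d + 4)).
  have r0 : 0 < r by rewrite lt_min ltr01 divr_gt0 ?exprn_gt0//; lra.
  have r1 : r <= 1 by rewrite ge_min lexx.
  have rs : r * (8 * d + 4) <= s ^+ 2.
    by rewrite -ler_pdivlMr ?ge_min ?lexx ?orbT//; lra.
  have /filter_ex[x [fx xr]] : F (B r) by exists r.
  exists x, r => // y [fy yr]; rewrite -ball_normE /= rnormE ltcR.
  rewrite -(@ltr_pXn2r _ 2) ?nnegrE ?rnorm_ge0 ?(ltW s0)//.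
  have := parallelogram x y; rewrite !rnormE.
  rewrite -!rmorphXn /= -[2]/(2%:R) -!(rmorph_nat (@real_complex R)).
  rewrite -!rmorphM -!rmorphD /= => /complexI.
  have := halfB _ _ fx fy; have := rnorm_ge0 x; have := rnorm_ge0 y.
  move: xr yr; set p := rnorm (x + y); set q := rnorm (x - y).
  move: (rnorm x) (rnorm y) => nx ny *.
  have : 4 * d ^+ 2 <= p ^+ 2 by nra.
  nra.
move=> /cauchy_cvg Fx; pose x := lim F.
have approx (r : R) : 0 < r -> exists y,
    [/\ f y = 1, rnorm y < d + r & rnorm (x - y) < r].
  move=> r0; have Br : F (B r) by exists r.
  have xr : F (ball x r%:C) by apply: (fcvg_ball Fx); rewrite ltcR.
  have [y [[fy yr]]] := filter_ex (filterI Br xr).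
  by rewrite -ball_normE /= rnormE ltcR; exists y.
exists x => [|y /d_le].
  apply/eqP; rewrite -subr_eq0 -normr_eq0 eq_le normr_ge0 andbT.
  have nE : `|f x - 1| = (complex.Re `|f x - 1|)%:C.
    by rewrite RRe_real// normr_real.
  rewrite nE lecR; apply/ler_addgt0Pl => r r0; rewrite addr0.
  (* Dividing by [|M| + 1] is safe whatever the sign of [M]. *)
  have M1 : 0 < `|M| + 1 by have := normr_ge0 M; lra.
  have [|y [fy _ xy]] := approx (r / (`|M| + 1)); first by rewrite divr_gt0.
  rewrite -lecR -nE -fy -linearB; apply: le_trans (fM _) _.
  rewrite rnormE -rmorphM lecR; move: xy; rewrite ltr_pdivlMr//.
  by have := ler_norm M; have := rnorm_ge0 (x - y); nra.
rewrite !rnormE lecR; apply: le_trans => {y}.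
apply/ler_addgt0Pl => r r0.
have [|y [_ yr xy]] := approx (r / 2); first by rewrite divr_gt0.
have : `|x| <= `|x - y| + `|y| by rewrite -[in leLHS](subrK y x) ler_normD.
rewrite !rnormE -rmorphD lecR; lra.
Qed.

(** The shortest vector [x] with [f x = 1] is orthogonal to the kernel of [f], so a multiple of it
    represents [f]. *)
Lemma riesz (f : {scalar H}) (M : R) :
  (forall x, `|f x| <= M%:C * `|x|) -> exists z, forall x, f x = <[x, z]>.
Proof.
move=> fM; have [f0|nf0] := pselect (forall x, f x = 0).
  by exists 0 => x; rewrite f0 linear0r.
have [|x fx xmin] := min_norm_vector fM.
  by move/existsNP: nf0 => [x /eqP]; exists x.
have x0 : <[x, x]> != 0.
  rewrite dnorm_eq0; apply: contraTneq (oner_neq0 R[i]) => x0.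
  by rewrite -fx x0 linear0 eqxx.
have x_perp v : f v = 0 -> <[x, v]> = 0.
  move=> fv; have [->|v0] := eqVneq v 0; first by rewrite linear0r.
  pose e := `|v|^-1 *: v.
  have fe : f e = 0 by rewrite linearZ /= fv mulr0.
  have e1 : `|e| = 1 by rewrite normrZ normfV normr_id mulVf// normr_eq0.
  (* Removing the component along the kernel vector [e] keeps [f = 1], and would shorten [x] unless
     that component vanishes. *)
  have : `|x| ^+ 2 <= `|x - <[x, e]> *: e| ^+ 2.
    rewrite ler_pXn2r ?nnegrE//; apply: xmin.
    by rewrite linearB linearZ /= fe mulr0 subr0.
  rewrite (pythagoras_unit _ e1) gerDr.
  move=> h; have : `|<[x, e]>| ^+ 2 == 0 by rewrite eq_le h exprn_ge0.
  rewrite expf_eq0 normr_eq0 innerZr mulf_eq0 conjC_eq0 invr_eq0 normr_eq0.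
  by rewrite (negPf v0) => /eqP.
have xx : (<[x, x]>)^*%R = <[x, x]> by rewrite -innerC.
exists (<[x, x]>^-1 *: x) => y.
(* [y - f y *: x] lies in the kernel of [f]. *)
have : <[x, y - f y *: x]> = 0.
  by apply: x_perp; rewrite linearB linearZ /= fx mulr1 subrr.
rewrite innerBr innerZr => /eqP; rewrite subr_eq0 => /eqP xy.
rewrite innerZr (innerC y x) xy rmorphM /= conjCK xx fmorphV /= xx.
by rewrite mulrCA mulVf ?mulr1.
Qed.

(** * Adjoints *)

Lemma adjointP A y z :
  (forall x, <[A x, y]> = <[x, z]>) -> adjoint A y = z.
Proof.
move=> Ayz; apply: inner_ext => x; rewrite -Ayz /adjoint.
by case: xgetP => [w _ -> //|/(_ z)].
Qed.

Lemma adjoint_inner A x y : boundedLinear A ->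
  <[A x, y]> = <[x, adjoint A y]>.
Proof.
move=> [lA [M AM]].
pose f x : R[i] := <[A x, y]>.
have lf : scalar f by move=> a u v; rewrite /f lA linearPl.
pose g : {scalar H} := HB.pack f (GRing.isLinear.Build _ _ _ _ f lf).
have [|z gz] := @riesz g (M * rnorm y); last by rewrite (adjointP gz) -gz.
move=> v; apply: le_trans (cauchy_schwarz _ _) _.
by rewrite rmorphM /= -rnormE mulrAC ler_wpM2r.
Qed.

(** * Multiples of the projection onto a line *)

(** For a unit vector [e] this is [a P], with [P] the orthogonal projection onto the span of [e]. *)
Definition rank1 e a : H -> H := fun x => (a * <[x, e]>) *: e.

Section Rank1.
Context (e : H) (e1 : `|e| = 1).

Let ee : <[e, e]> = 1. Proof. by rewrite inner_norm e1 expr1n. Qed.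

Lemma rank1_inj : injective (rank1 e).
Proof.
move=> a b /(congr1 (fun A => <[A e, e]>)).
by rewrite /rank1 !innerZl ee !mulr1.
Qed.

Lemma rank1_comp a b : rank1 e a \o rank1 e b = rank1 e (a * b).
Proof.
by apply/funext => x; rewrite /rank1 /= innerZl ee mulr1 mulrA.
Qed.

Lemma adjoint_rank1 a : adjoint (rank1 e a) = rank1 e a^*%R.
Proof.
apply/funext => y; apply: adjointP => x.
rewrite /rank1 innerZl innerZr rmorphM /= conjCK -innerC; ring.
Qed.

Lemma rank1_boundedLinear a : boundedLinear (rank1 e a).
Proof.
split=> [c x y|].
  by rewrite /rank1 linearPl mulrDr scalerDl scalerA mulrCA.
exists (complex.Re `|a|) => x.
rewrite RRe_real ?normr_real// normrZ e1 mulr1 normrM.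
by rewrite ler_wpM2l// norm_inner_unit_le.
Qed.

Lemma opnorm_rank1 a : (opnorm (rank1 e a))%:C = `|a|.
Proof.
rewrite -[RHS]RRe_real ?normr_real//; congr (_%:C).
have nE x : `|rank1 e a x| = `|a| * `|<[x, e]>|.
  by rewrite normrZ e1 mulr1 normrM.
apply/eqP; rewrite eq_le; apply/andP; split.
  apply: ge_sup.
    by exists (complex.Re `|rank1 e a 0|); exists 0; rewrite //= normr0.
  move=> _ [x /= x1 <-]; rewrite -lecR !RRe_real ?normr_real//.
  by rewrite nE ler_piMr// (le_trans (norm_inner_unit_le _ e1)).
apply: ub_le_sup.
  exists (complex.Re `|a|) => _ [x /= x1 <-].
  rewrite -lecR !RRe_real ?normr_real//.
  by rewrite nE ler_piMr// (le_trans (norm_inner_unit_le _ e1)).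
(* The supremum is attained at [e]. *)
by exists e; rewrite /= ?e1// nE ee normr1 mulr1.
Qed.

Lemma orthonormal_basis_extend : exists2 E, orthonormal_basis E & E e.
Proof.
(* Zorn is applied to the sets that stay orthonormal once [e] is added, rather than to those
   containing [e], so that the union of the empty chain qualifies. *)
have [|A [oA Amax]] :=
    @Zorn_bigcup H [set E | orthonormal_set (E `|` [set e])].
  move=> F FP Ftot x y [[X FX Xx]|/= ->] [[Y FY Yy]|/= ->].
  - have [/(_ _ Xx)Yx|/(_ _ Yy)Xy] := Ftot _ _ FX FY.
      by apply: (FP _ FY); left.
    by apply: (FP _ FX); left.
  - by apply: (FP _ FX); [left|right].
  - by apply: (FP _ FY); [right|left].
  - by rewrite ee eqxx.
exists (A `|` [set e]); last by right.
split=> // F oF AF; apply/seteqP; split=> //.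
have [/subset_trans FA|FA] := pselect (F `<=` A); first exact: FA.
exfalso; apply: (Amax F).
  by split=> //; apply: subset_trans AF; left.
by rewrite /= setUidl// => _ ->; apply: AF; right.
Qed.

Lemma optrace_rank1 a : optrace (rank1 e a) <> 0 -> optrace (rank1 e a) = a.
Proof.
(* The hypothesis rules out the junk value, so some [t] is the sum of the
   diagonal in every basis; in a basis containing [e] the only nonzero diagonal
   entry is [a]. *)
rewrite /optrace; case: xgetP => [t _ tr _|//].
have [E oE Ee] := orthonormal_basis_extend.
have [oE' _] := oE; have tE := @totally_filter E.
apply: (cvg_unique (@norm_hausdorff _ R[i]^o) (tr E oE)).
apply: (@cvg_near_cst _ R[i]^o).
pose e' : E := SigSub (mem_set Ee).
exists [fset e']%fset => // A /= /fsubsetP sA.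
have eA : e' \in A by apply: sA; rewrite inE.
rewrite /partial_sum (bigD1 [` eA]%fset) //= big1 ?addr0.
  by rewrite innerZl ee !mulr1.
move=> i ie; rewrite innerZl oE' ?Ee//; last exact: set_valP.
have [ie'|_] := eqVneq (sval (fsval i)) e; last by rewrite mulr0 mul0r.
by case/eqP: ie; do 2!apply: val_inj.
Qed.

End Rank1.

(** * Normal operators of rank one *)

Lemma rank_one_normal_rank1 T : boundedLinear T -> rank_one T -> normal_op T ->
  exists e a, [/\ `|e| = 1, a != 0 & T = rank1 e a].
Proof.
move=> Tb [u /eqP u0 rT] nT.
have uu : <[u, u]> != 0 by rewrite dnorm_eq0.
pose w := adjoint T u.
have TE x : T x = (<[x, w]> / <[u, u]>) *: u.
  have : range T (T x) by exists x.
  rewrite rT => -[c _ cu]; rewrite -adjoint_inner// -cu innerZl.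
  by rewrite mulfK.
have w0 : w != 0.
  apply: contra_neq u0 => w0.
  have : range T u by rewrite rT; exists 1 => //; rewrite scale1r.
  by case=> x _ <-; rewrite TE w0 linear0r mul0r scale0r.
have ww : <[w, w]> != 0 by rewrite dnorm_eq0.
(* Normality evaluated at [u]: [T w] is a multiple of [u] and the adjoint sends [T u] to a multiple
   of [w], so the two vectors are parallel. *)
have uw : <[w, w]> *: u = <[u, w]> *: w.
  have : T (adjoint T u) = adjoint T (T u) by exact: (congr1 (@^~ u) nT).
  have -> : adjoint T (T u) = (<[u, w]> / <[u, u]>) *: w.
    apply: adjointP => x; rewrite (TE u) innerZr [RHS]innerZr; congr (_ * _).
    by rewrite adjoint_inner.
  rewrite -/w TE => /(congr1 (GRing.scale <[u, u]>)).
  by rewrite !scalerA !mulrA !(mulrC <[u, u]>) !mulfK// => ->.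
have nw0 : `|w| != 0 by rewrite normr_eq0.
pose e := `|w|^-1 *: w.
have e1 : `|e| = 1 by rewrite normrZ normfV normr_id mulVf.
have we : w = `|w| *: e by rewrite scalerA mulfV// scale1r.
have ue : u = (<[u, w]> / <[w, w]> * `|w|) *: e.
  by rewrite -scalerA -we mulrC -scalerA -uw scalerA mulVf// scale1r.
move: (_ * `|w|) ue => k ue.
have TE' : T = rank1 e (`|w| / <[u, u]> * k).
  apply/funext => x; rewrite TE /rank1 [in LHS]we [in RHS]innerC.
  rewrite innerZr [X in _ *: X = _]ue scalerA; congr (_ *: _).
  rewrite -innerC (CrealP (normr_real w)); ring.
exists e, (`|w| / <[u, u]> * k); split=> //.
rewrite !mulf_neq0 ?invr_eq0//.
by apply: contra_neq u0 => k0; rewrite ue k0 scale0r.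
Qed.

(** * The semigroup generated by [a P] and its adjoint *)

(** Coefficients multiply under composition, so a word is determined by how often each letter occurs
    in it. *)
Lemma semigroup_adj_rank1 e a A : `|e| = 1 ->
  semigroup_adj (rank1 e a) A <->
  exists m n, (0 < m + n)%N /\ A = rank1 e (a ^+ m * a^*%R ^+ n).
Proof.
move=> e1; split=> [|[m [n [+ ->]]]].
  elim=> [B [->|->]|B W + _ [m [n [mn ->]]]].
  - by exists 1%N, 0%N; rewrite mulr1.
  - by exists 0%N, 1%N; rewrite mul1r adjoint_rank1.
  - case=> ->; rewrite ?adjoint_rank1// rank1_comp//.
      by exists m.+1, n; rewrite exprS mulrA.
    by exists m, n.+1; rewrite addnS exprS mulrCA.
elim: m => [|m IHm] mn.
  case: n mn => // n _; elim: n => [|n IHn].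
    by rewrite mul1r expr1 -adjoint_rank1//; apply: word_letter; right.
  rewrite exprS mulrCA -rank1_comp//; apply: word_cons => //.
  by right; rewrite adjoint_rank1.
(* Words are nonempty: with no letters left, the word is [T] alone. *)
have [mn0|] := posnP (m + n).
  move: mn0 => /eqP; rewrite addn_eq0 => /andP[/eqP-> /eqP->].
  by rewrite mulr1 expr1; apply: word_letter; left.
move=> /IHm ?; rewrite exprS -mulrA -rank1_comp//.
by apply: word_cons => //; left.
Qed.

Lemma semigroup_semigroup_adj_rank1 e a : `|e| = 1 ->
  semigroup (semigroup_adj (rank1 e a)).
Proof.
move=> e1; split=> [A /semigroup_adj_rank1[]// m [n [_ ->]]|A B].
  exact: rank1_boundedLinear.
move=> /semigroup_adj_rank1[]// m [n [mn ->]].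
move=> /semigroup_adj_rank1[]// p [q [pq ->]].
rewrite rank1_comp//; apply/semigroup_adj_rank1 => //.
by exists (m + p)%N, (n + q)%N; rewrite addnACA addn_gt0 mn mulrACA -!exprD.
Qed.

Lemma semigroup_adj_adjoint_rank1 e a A : `|e| = 1 ->
  semigroup_adj (rank1 e a) A -> semigroup_adj (rank1 e a) (adjoint A).
Proof.
move=> e1 /semigroup_adj_rank1[]// m [n [mn ->]].
apply/semigroup_adj_rank1 => //; exists n, m; rewrite addnC mn.
by rewrite adjoint_rank1// rmorphM !rmorphXn /= conjCK mulrC.
Qed.

(** * The three conditions in terms of [a] *)

Lemma SI_norm1 e a : `|e| = 1 -> a != 0 -> ~ selfadjoint (rank1 e a) ->
  SI_semigroup (semigroup_adj (rank1 e a)) -> `|a| = 1.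
Proof.
move=> e1 a0 nsa [[_ SM] SI]; set T := rank1 e a in nsa SI SM *.
have ST : semigroup_adj T T by apply: word_letter; left.
have comm A X : semigroup_adj T A -> semigroup_adj T X -> A \o X = X \o A.
  move=> /semigroup_adj_rank1[]// m [n [_ ->]].
  move=> /semigroup_adj_rank1[]// p [q [_ ->]].
  by rewrite !rank1_comp// mulrC.
(* The principal ideal of [T]: [T] is added separately since the semigroup may lack a unit, and
   commutativity makes one-sided products enough. *)
pose J := [set T] `|` [set T \o X | X in semigroup_adj T].
have idJ : semigroup_ideal (semigroup_adj T) J.
  have JS : J `<=` semigroup_adj T.
    by move=> _ [->//|[X SX <-]]; apply: SM.
  split=> // A X JA SX.
  suff JAX : J (A \o X) by rewrite (comm X A)//; apply: JS.
  case: JA => [->|[Y SY <-]]; right; first by exists X.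
  by exists (Y \o X) => //; apply: SM.
have [] := SI J idJ (adjoint T); first by exists T => //; left.
  by move=> /nsa.
move=> [X /semigroup_adj_rank1[]// m [n [mn ->]]].
rewrite /T rank1_comp// adjoint_rank1// => /(rank1_inj e1) /(congr1 Num.norm).
(* Moduli give [|a| |a|^(m + n) = |a|] with [m + n > 0]. *)
rewrite !normrM !normrX norm_conjC -exprD -[in RHS](mulr1 `|a|).
move=> /(mulfI _); rewrite normr_eq0 => /(_ a0)/eqP.
by rewrite pexprn_eq1 ?normr_ge0// -[m + n == 0]negbK -lt0n mn => /eqP.
Qed.

Lemma norm1_simple e a : `|e| = 1 -> `|a| = 1 ->
  simple_semigroup (semigroup_adj (rank1 e a)).
Proof.
move=> e1 a1; split; first exact: semigroup_semigroup_adj_rank1.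
move=> J [JS idJ] [A JA _]; apply/seteqP; split=> // X SX.
(* For [A = c P] with [|c| = 1], the adjoint of [A] times [A] is [P], the unit of the semigroup; an
   ideal containing it is everything. *)
have J1 : J (rank1 e 1).
  have [+ _] := idJ _ _ JA (semigroup_adj_adjoint_rank1 e1 (JS _ JA)).
  have [m [n [_ ->]]] := (semigroup_adj_rank1 _ _ e1).1 (JS _ JA).
  rewrite adjoint_rank1// rank1_comp// mulrC -normCK.
  by rewrite normrM !normrX norm_conjC a1 !expr1n mulr1 expr1n.
have [+ _] := idJ _ _ J1 SX.
have [m [n [_ ->]]] := (semigroup_adj_rank1 _ _ e1).1 SX.
by rewrite rank1_comp// mulr1.
Qed.

(** Since [a] is nonzero, no word vanishes; a nonempty ideal is therefore the whole semigroup, which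
    is closed under adjoints. *)
Lemma simple_SI e a : `|e| = 1 -> a != 0 ->
  simple_semigroup (semigroup_adj (rank1 e a)) ->
  SI_semigroup (semigroup_adj (rank1 e a)).
Proof.
move=> e1 a0 [S simpleS]; split=> // J idJ _ [A JA <-].
have SA := idJ.1 _ JA.
rewrite (simpleS J) //; first exact: semigroup_adj_adjoint_rank1.
exists A => //; have [m [n [_ ->]]] := (semigroup_adj_rank1 _ _ e1).1 SA.
have -> : cst 0 = rank1 e 0 by apply/funext => x; rewrite /rank1 mul0r scale0r.
move=> /(rank1_inj e1)/eqP.
by rewrite mulf_eq0 !expf_eq0 conjC_eq0 (negPf a0) !andbF.
Qed.

End HilbertSpace.

Theorem theorem3p11 (R : realType) (H : hilbertType R) (T : H -> H)
    (T_BH : boundedLinear T) (T_rank1 : rank_one T) (T_normal : normal_op T)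
    (T_nsa : ~ selfadjoint T) (T_tr : optrace T <> 0) :
  (SI_semigroup (semigroup_adj T) <->
     (opnorm T)%:C = `|optrace T| /\ `|optrace T| = 1) /\
  ((opnorm T)%:C = `|optrace T| /\ `|optrace T| = 1 <->
     simple_semigroup (semigroup_adj T)).
Proof.
have [e [a [e1 a0 TE]]] := rank_one_normal_rank1 T_BH T_rank1 T_normal.
(* The norm becomes [|a|] and the trace [a], so the middle condition reads [|a| = 1]. *)
rewrite TE in T_nsa T_tr *; rewrite opnorm_rank1// optrace_rank1//.
have SI1 := SI_norm1 e1 a0 T_nsa.
have simp1 := simple_SI e1 a0.
split; split.
- by move=> /SI1.
- by move=> [_ a1]; apply/simp1/norm1_simple.
- by move=> [_ a1]; apply: norm1_simple.
- by move=> /simp1/SI1.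
Qed.
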